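(* Let $n\ge 1$ be an integer, let $D_{2n}=\langle \sigma,\tau \mid \sigma^n=\tau^2=e,\ \tau\sigma\tau=\sigma^{-1}\rangle$ be the dihedral group of order $2n$, and let $X=X(D_{2n},S)$ be its Cayley graph with $S=\{\sigma,\tau\}$. Then the Bowen--Franks group $\mathcal{BF}(X)$ is infinite if and only if $6\mid n$. Otherwise $\mathcal{BF}(X)$ is finite and \[ |\mathcal{BF}(X)|=\begin{cases}1 & \text{if } n\equiv\pm1\pmod 6,\\ 3 & \text{if } n\equiv\pm2\pmod 6,\\ 4 & \text{if } n\equiv 3\pmod 6.\end{cases} \]
   Context: For a group $G$ and a generating set $S$ of $G$, the (directed) Cayley graph $X(G,S)$ has vertex set $G$ and, for every $g\in G$ and $s\in S$, one directed edge from $g$ to $gs$ (loops and multiple edges allowed). For a finite digraph $X$ with $N$ vertices $v_1,\dots,v_N$, the adjacency matrix $A_X=[a_{ij}]$ has $a_{ij}$ equal to the number of edges from $v_i$ to $v_j$. The Bowen--Franks group is $\mathcal{BF}(X)=\operatorname{coker}(\mathrm{Id}-A_X)=\mathbb{Z}^N/(\mathrm{Id}-A_X)\mathbb{Z}^N$. *)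

(* Defs.v *)
From HB Require Import structures.
From mathcomp Require Import all_boot all_order all_algebra all_fingroup.
From mathcomp Require Import boolp classical_sets cardinality.

Set Implicit Arguments.
Unset Strict Implicit.
Unset Printing Implicit Defensive.

Import GRing.Theory.

(* Loops and multiple edges are allowed: edges form a type of their own. *)
Record digraph := Digraph {
  vertex : finType;
  edge : finType;
  source : edge -> vertex;
  target : edge -> vertex }.

Definition cayley_digraph (gT : finGroupType) (S : {set gT}) : digraph :=
  @Digraph gT (gT * {s : gT | s \in S})%type
    (fun e => e.1) (fun e => (e.1 * val e.2)%g).

(* The vertices are numbered by their canonical enumeration [enum_val]. *)
Definition adjacency (X : digraph) : 'M[int]_#|vertex X| :=
  (\matrix_(i, j)
    #|[set e : edge X | (source e == enum_val i)
                        && (target e == enum_val j)]|%:Z)%R.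

Definition int_image (N : nat) (M : 'M[int]_N) : {pred 'cV[int]_N} := fun x =>
  `[< exists y : 'cV[int]_N, x = (M *m y)%R >].

Lemma int_image_zmod_closed (N : nat) (M : 'M[int]_N) :
  zmod_closed (int_image M).
Proof.
split=> [|_ _ /asboolP[y ->] /asboolP[z ->]]; apply/asboolP.
  by exists 0%R; rewrite mulmx0.
by exists (y - z)%R; rewrite mulmxBr.
Qed.

HB.instance Definition _ (N : nat) (M : 'M[int]_N) :=
  GRing.isZmodClosed.Build 'cV[int]_N (int_image M)
    (int_image_zmod_closed M).

Definition coker (N : nat) (M : 'M[int]_N) : zmodType :=
  Quotient.quot (int_image M).

Definition bowen_franks (X : digraph) : zmodType :=
  coker (1%:M - adjacency X)%R.

Section Dihedral.
Local Open Scope group_scope.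

Definition dihedral_rel (n : nat) (rT : groupType) (x y : rT) : Prop :=
  [/\ x ^+ n = 1, y ^+ 2 = 1 & y * x * y = x^-1].

(* gT is the group <s, t | s^n = t^2 = e, t s t = s^-1>, with s and t the
   images of the two formal generators: they generate gT, satisfy the
   relations, and are universal for them among all groups. *)
Definition dihedral_presentation (n : nat) (gT : finGroupType) (s t : gT)
    : Prop :=
  [/\ <<[set s; t]>> = [set: gT],
      dihedral_rel n s t
    & forall (rT : groupType) (x y : rT), dihedral_rel n x y ->
        exists f : gT -> rT,
          [/\ {morph f : u v / u * v >-> u * v}, f s = x & f t = y]].

End Dihedral.

(* A model of the presentation for n = m + 1, showing that it is satisfiable
   and of order 2n: the pair (a, b) stands for s^a t^b. *)
Definition dihedral_model (m : nat) := ('I_m.+1 * bool)%type.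
HB.instance Definition _ m := Finite.on (dihedral_model m).

Section DihedralModel.
Local Open Scope ring_scope.
Variable m : nat.
Local Notation D := (dihedral_model m).

Definition flip (b : bool) (a : 'I_m.+1) := if b then - a else a.
Definition dih_mul (u v : D) : D := (u.1 + flip u.2 v.1, u.2 (+) v.2).
Definition dih_inv (u : D) : D := (- flip u.2 u.1, u.2).

Lemma dih_mulA : associative dih_mul.
Proof.
move=> [a b] [c d] [e f]; rewrite /dih_mul /flip /= addbA; congr pair.
by case: b; case: d; rewrite /= ?opprD ?opprK addrA.
Qed.
Lemma dih_mul1 : left_id ((0, false) : D) dih_mul.
Proof. by move=> [a b]; rewrite /dih_mul /= add0r. Qed.
Lemma dih_mulV : left_inverse ((0, false) : D) dih_inv dih_mul.
Proof.
move=> [a b]; rewrite /dih_mul /dih_inv /flip /= addbb; congr pair.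
by case: b; rewrite /= ?opprK ?addNr ?subrr.
Qed.
HB.instance Definition _ :=
  Finite_isGroup.Build (dihedral_model m) dih_mulA dih_mul1 dih_mulV.
End DihedralModel.

Section DihedralExists.
Local Open Scope group_scope.

Lemma dihedral_presentation_exists n : 0 < n ->
  exists (gT : finGroupType) (s t : gT),
    dihedral_presentation n s t /\ #|gT| = n.*2.
Proof.
case: n => // m _.
pose s : dihedral_model m := (inZp 1, false).
pose t : dihedral_model m := (0%R, true).
have mE (u v : dihedral_model m) : u * v = dih_mul u v by [].
have sX k : s ^+ k = (inZp k, false) :> dihedral_model m.
  elim: k => [|k IH]; first by rewrite expg0; congr pair; apply: val_inj; rewrite /= mod0n.
  rewrite expgSr IH mE /dih_mul /flip /=; congr pair; apply: val_inj => /=.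
  by rewrite modnDm addn1.
have tE : t ^+ 2 = 1.
  by rewrite expgS expg1 mE /dih_mul /flip /= oppr0 addr0.
exists (dihedral_model m), s, t; split; last first.
  by rewrite card_prod card_ord card_bool muln2.
have dec (u : dihedral_model m) : u = s ^+ u.1 * t ^+ u.2.
  rewrite sX; case: u => a [] /=; rewrite ?expg1 ?expg0 ?mulg1 ?mE /dih_mul /flip /=;
    by rewrite ?addr0; congr pair; apply: val_inj; rewrite /= modn_small.
split.
- apply/setP => u; rewrite inE (dec u) groupM // groupX // mem_gen //.
  + by rewrite !inE eqxx.
  + by rewrite !inE eqxx orbT.
- split=> //.
    by rewrite sX; congr pair; apply: val_inj; rewrite /= modnn.
  have -> : s^-1 = dih_inv s by [].
  rewrite !mE /dih_mul /flip /dih_inv /flip /=; congr pair.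
  by rewrite add0r oppr0 addr0.
move=> rT x y [xn y2 yxy].
exists (fun u : dihedral_model m => x ^+ u.1 * y ^+ u.2); split.
- have xmod k : x ^+ (k %% m.+1) = x ^+ k.
    by rewrite {2}(divn_eq k m.+1) expgD mulnC expgM xn expg1n mul1g.
  have yy : y * y = 1 by [].
  have yX k : y * x ^+ k = x ^- k * y.
    elim: k => [|k IH]; first by rewrite expg0 invg1 mulg1 mul1g.
    rewrite [in LHS]expgSr mulgA IH expgS invMg -mulgA -mulgA; congr (_ * _).
    by rewrite -yxy -!mulgA yy mulg1.
  have xopp (c : 'I_m.+1) : x ^+ (- c)%R = x ^- c.
    rewrite /= xmod; apply: (mulgI (x ^+ c)); rewrite mulgV -expgD subnKC //.
    exact: ltnW.
  move=> [a b] [c d]; rewrite mE /dih_mul /flip /=; rewrite xmod expgD.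
  case: b => /=; last by rewrite mulg1 mulgA.
  rewrite xopp -!mulgA; congr (_ * _); rewrite !mulgA yX -mulgA; congr (_ * _).
  by case: d; rewrite ?yy ?mulg1.
- rewrite /= mulg1 -[RHS]expg1 [in RHS](divn_eq 1 m.+1) expgD mulnC expgM.
  by rewrite xn expg1n mul1g.
- by rewrite /= mul1g.
Qed.

End DihedralExists.

(* Main.v *)
Require Import Defs.
From HB Require Import structures.
From mathcomp Require Import all_boot all_order all_algebra all_fingroup.
From mathcomp Require Import boolp classical_sets cardinality.
From mathcomp Require Import zify.

Set Implicit Arguments.
Unset Strict Implicit.
Unset Printing Implicit Defensive.
Import GRing.Theory.

(** The Bowen-Franks group of a digraph is the abelian group generated by the
    classes [v] of the vertices, with one relation per vertex: column v of
    Id - A says that [v] is the sum of the classes of the sources of the edges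
    that end at v ([vertex_class_span], [vertex_class_in_edges],
    [bowen_franks_lift]).

    For the Cayley graph of the dihedral group these relations read
      [g] = [g sigma^-1] + [g tau].
    Put a_k = [sigma^k].  The relations at sigma^k tau and at sigma^(k+1)
    have the same right-hand side, so [sigma^k tau] = a_(k+1).  The reflections
    are therefore redundant generators, and the remaining relations are
      a_(k+1) = a_k + a_(k+2)   and   a_(k+n) = a_k.
    The recurrence is that of the powers of a primitive sixth root of unity
    omega, the root of X^2 - X + 1.  Hence every a_k is an integer combination
    of a_0 and a_1, the sequence has period 6, and the group is
    Z[omega] / (omega^n - 1), with a_0 and a_1 corresponding to 1 and omega
    ([dihedral_hex_presented]).

    It remains to read off omega^n - 1 from n mod 6.  It is a unit for
    n = 1, -1; for n = 2, -2 it is associate to omega^2 - 1, of norm 3, and the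
    quotient is Z/3; for n = 3 it is -2 and the quotient is (Z/2)^2; for n = 0
    it vanishes and the group is Z[omega], which is infinite. *)

(** * Cokernels of integer matrices *)

Section Cokernel.
Local Open Scope ring_scope.
Variables (N : nat) (M : 'M[int]_N).

Definition coker_pi (x : 'cV[int]_N) : coker M :=
  (\pi_({ideal_quot (int_image M)}) x)%qT.

Lemma coker_pi_is_zmod_morphism : zmod_morphism coker_pi.
Proof. by move=> x y; rewrite /coker_pi raddfB. Qed.

HB.instance Definition _ :=
  GRing.isZmodMorphism.Build _ _ coker_pi coker_pi_is_zmod_morphism.

Lemma coker_pi_eq0 x : coker_pi x = 0 <-> exists y, x = M *m y.
Proof.
have pi_eq0 : (coker_pi x == 0) = (x \in int_image M).
  by rewrite -(raddf0 coker_pi) -Quotient.idealrBE subr0.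
split=> [/eqP|xM]; first by rewrite pi_eq0 => /asboolP.
by apply/eqP; rewrite pi_eq0; apply/asboolP.
Qed.

Lemma coker_pi_surj u : exists x, coker_pi x = u.
Proof.
exists (generic_quotient.repr (u : {ideal_quot (int_image M)})); exact: reprK.
Qed.

(** Universal property of the quotient. *)
Lemma coker_lift (T : zmodType) (psi : {additive 'cV[int]_N -> T}) :
    (forall y, psi (M *m y) = 0) ->
  exists phi : {additive coker M -> T}, forall x, phi (coker_pi x) = psi x.
Proof.
move=> psi0; pose phi (u : coker M) :=
  psi (generic_quotient.repr (u : {ideal_quot (int_image M)})).
have phiE x : phi (coker_pi x) = psi x.
  apply/eqP; rewrite -subr_eq0 -raddfB.
  have /coker_pi_eq0[y ->] : coker_pi
      (generic_quotient.repr (coker_pi x : {ideal_quot (int_image M)}) - x) = 0.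
    apply/eqP; rewrite raddfB subr_eq0; apply/eqP; exact: reprK.
  by rewrite psi0.
have phiB : zmod_morphism phi.
  move=> u v; have [x <-] := coker_pi_surj u; have [y <-] := coker_pi_surj v.
  by rewrite -raddfB !phiE raddfB.
pose phiM := GRing.isZmodMorphism.Build _ _ phi phiB.
pose phiA : {additive coker M -> T} := HB.pack phi phiM.
by exists phiA.
Qed.

End Cokernel.

(** * Generators and relations for the Bowen-Franks group *)

Section BowenFranks.
Local Open Scope ring_scope.
Variable X : digraph.

Definition vertex_class (v : vertex X) : bowen_franks X :=
  coker_pi _ (delta_mx (enum_rank v) 0).

(** A sum weighted by the number of edges from each vertex to a given one is a
    sum over these edges; this form no longer depends on the numbering of the
    vertices. *)
Lemma sum_adjacency_col (T : zmodType) (w : vertex X -> T)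
    (j : 'I_#|vertex X|) :
  \sum_i w (enum_val i) *~ adjacency X i j
  = \sum_(e | target e == enum_val j) w (source e).
Proof.
rewrite (partition_big (fun e => enum_rank (source e)) predT) //=.
apply: eq_bigr => i _; rewrite mxE -sum1_card -pmulrn -sumrMnr.
apply: eq_big => e; first by rewrite inE andbC (can2_eq enum_rankK enum_valK).
by rewrite inE => /andP[/eqP-> _].
Qed.


Lemma sum_laplacian_col (T : zmodType) (w : vertex X -> T)
    (j : 'I_#|vertex X|) :
  \sum_i w (enum_val i) *~ (1%:M - adjacency X) i j
  = w (enum_val j) - \sum_(e | target e == enum_val j) w (source e).
Proof.
rewrite -sum_adjacency_col -[w (enum_val j)]mulr1z.
under eq_bigr do rewrite mxE [(- _ : 'M__) _ _]mxE mulrzBr.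
rewrite sumrB; congr (_ - _); rewrite (bigD1 j) //= big1 ?addr0.
  by rewrite mxE eqxx.
by move=> i /negPf nij; rewrite mxE nij mulr0z.
Qed.

Lemma int_col_sum_delta N (x : 'cV[int]_N) :
  x = \sum_i delta_mx i 0 *~ x i 0.
Proof.
apply/matrixP=> i k; rewrite ord1 summxE (bigD1 i) //= big1 ?addr0.
  by rewrite -scaler_int !mxE !eqxx mulr1 intz.
by move=> h /negPf nhi; rewrite -scaler_int !mxE eq_sym nhi mulr0.
Qed.

(** The relation carried by column v of Id - A, that is, by the image of the
    standard basis vector of v. *)
Lemma vertex_class_in_edges v :
  vertex_class v = \sum_(e | target e == v) vertex_class (source e).
Proof.
apply/eqP; rewrite -subr_eq0 -(enum_rankK v) -sum_laplacian_col; apply/eqP.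
pose d : 'cV[int]_#|vertex X| := delta_mx (enum_rank v) 0.
have: coker_pi (1%:M - adjacency X) ((1%:M - adjacency X) *m d) = 0.
  by apply/coker_pi_eq0; exists d.
rewrite {1}(int_col_sum_delta (_ *m d)) raddf_sum => /(etrans _); apply.
apply: eq_bigr => i _.
by rewrite raddfMz -[_ *m d]colE [col _ _ _ _]mxE /vertex_class enum_valK.
Qed.

Lemma vertex_class_span (x : bowen_franks X) :
  exists m : vertex X -> int, x = \sum_v vertex_class v *~ m v.
Proof.
have [y <-] := coker_pi_surj x; exists (fun v => y (enum_rank v) 0).
rewrite {1}(int_col_sum_delta y) raddf_sum (reindex enum_rank) /=; last first.
  exact: onW_bij (enum_rank_bij _).
by apply: eq_bigr => v _; rewrite raddfMz.
Qed.

(** The columns of Id - A generate its image, so there are no relations beyond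
    those of [vertex_class_in_edges]. *)
Lemma bowen_franks_lift (T : zmodType) (w : vertex X -> T) :
    (forall v, w v = \sum_(e | target e == v) w (source e)) ->
  exists phi : {additive bowen_franks X -> T},
    forall v, phi (vertex_class v) = w v.
Proof.
move=> w_in; pose psi (x : 'cV[int]_#|vertex X|) :=
  \sum_i w (enum_val i) *~ x i 0.
have psiB : zmod_morphism psi.
  by move=> x y; rewrite -sumrB; apply: eq_bigr => i _; rewrite !mxE mulrzBr.
pose psiM := GRing.isZmodMorphism.Build _ _ psi psiB.
pose psiA : {additive 'cV[int]_#|vertex X| -> T} := HB.pack psi psiM.
have psi0 y : psiA ((1%:M - adjacency X) *m y) = 0.
  rewrite /= /psi; under eq_bigr do rewrite mxE mulrz_sumr.
  rewrite exchange_big big1 //= => j _.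
  under eq_bigr do rewrite mulrzA.
  by rewrite -mulrz_suml sum_laplacian_col -w_in subrr mul0rz.
have [phi phiE] := coker_lift psi0; exists phi => v.
rewrite phiE /= /psi (bigD1 (enum_rank v)) //= enum_rankK mxE !eqxx mulr1z.
by rewrite big1 ?addr0 // => i /negPf niv; rewrite mxE niv mulr0z.
Qed.

End BowenFranks.

(** * The recurrence of the sixth roots of unity *)

Section Hexagonal.
Local Open Scope ring_scope.
Variable T : zmodType.
Implicit Types (x y : T) (k : nat).

(** The value of omega^k when 1 and omega are sent to x and y, for omega a
    primitive sixth root of unity, so that omega^2 = omega - 1. *)
Definition hex x y k : T :=
  nth 0 [:: x; y; y - x; - x; - y; x - y] (k %% 6).

Lemma hex_mod x y k : hex x y (k %% 6) = hex x y k.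
Proof. by rewrite /hex modn_mod. Qed.

Lemma hex_modD x y k l : hex x y (k %% 6 + l) = hex x y (k + l).
Proof. by rewrite -hex_mod modnDml hex_mod. Qed.

Lemma hex_rec x y k : hex x y k.+1 = hex x y k + hex x y k.+2.
Proof.
have -> : hex x y k = hex x y (k + 0) by rewrite addn0.
rewrite -[k.+2]addn2 -[k.+1]addn1 -!(hex_modD _ _ k).
have := ltn_pmod k (isT : (0 < 6)%N).
case: (k %% 6)%N => [|[|[|[|[|[|//]]]]]] _; rewrite /hex /=;
  by rewrite ?addrA ?opprB ?subrr ?addNr ?sub0r ?add0r ?addr0 ?subrK ?addrN //
     addrC ?addrA ?addNr ?add0r ?subrK.
Qed.

Lemma hex_unique (c : nat -> T) :
  (forall k, c k.+1 = c k + c k.+2) -> c =1 hex (c 0) (c 1).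
Proof.
move=> c_rec k.
have [] // : c k = hex (c 0) (c 1) k /\ c k.+1 = hex (c 0) (c 1) k.+1.
elim: k => [|k [IH1 IH2]]; first by [].
split=> //; apply: (addrI (c k)).
by rewrite -c_rec IH2 hex_rec IH1.
Qed.

(** The recurrence is of order two, so two consecutive values that repeat
    after n steps make the whole sequence n-periodic. *)
Lemma hex_period x y n : hex x y n = x -> hex x y n.+1 = y ->
  forall k, hex x y (k + n) = hex x y k.
Proof.
move=> hn hn1 k; rewrite (@hex_unique (fun k => hex x y (k + n))%N) /=.
  by rewrite add0n add1n hn hn1.
by move=> l; rewrite !addSn hex_rec.
Qed.

Lemma hexS_mod x y k : hex x y (k %% 6).+1 = hex x y k.+1.
Proof. by rewrite -addn1 hex_modD addn1. Qed.

(** The next four lemmas solve omega^n = 1 on the pair (x, y), according to the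
    ideal generated by omega^n - 1: zero, everything, a prime of norm 3, and
    the ideal of 2. *)
Lemma hex_fixed_mod6_0 x y n : (n %% 6 = 0)%N ->
  hex x y n = x /\ hex x y n.+1 = y.
Proof. by move=> n6; rewrite -(hex_mod x y n) -(hexS_mod x y n) n6. Qed.

Lemma hex_fixed_mod6_pm1 x y n : (n %% 6 = 1 \/ n %% 6 = 5)%N ->
  hex x y n = x -> hex x y n.+1 = y -> x = 0 /\ y = 0.
Proof.
rewrite -(hex_mod x y n) -(hexS_mod x y n); case=> ->; rewrite /hex /=.
  by move=> ->; rewrite subrr.
by move=> /eqP; rewrite subr_eq addrC -subr_eq subrr => /eqP <- ->.
Qed.

Lemma hex_fixed_mod6_pm2 x y n : (n %% 6 = 2 \/ n %% 6 = 4)%N ->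
  (hex x y n = x /\ hex x y n.+1 = y) <-> (y = - x /\ x *+ 3 = 0).
Proof.
rewrite -(hex_mod x y n) -(hexS_mod x y n) mulrS mulr2n.
case=> ->; rewrite /hex /=; split=> -[].
- move=> yx ny; rewrite -ny; split=> //.
  by rewrite -{1}yx -ny addrACA addNr addr0.
- move=> -> x3; split=> //; apply/eqP.
  by rewrite -subr_eq0 -opprD -opprD -addrA x3 oppr0.
- move=> ny; have yx : y = - x by rewrite -ny opprK.
  by rewrite yx opprK => xx; rewrite xx subrr.
- move=> -> x3; rewrite !opprK; split=> //; apply/eqP.
  by rewrite -subr_eq0 opprK -addrA x3.
Qed.

Lemma hex_fixed_mod6_3 x y n : (n %% 6 = 3)%N ->
  (hex x y n = x /\ hex x y n.+1 = y) <-> (x *+ 2 = 0 /\ y *+ 2 = 0).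
Proof.
rewrite -(hex_mod x y n) -(hexS_mod x y n) !mulr2n => ->; rewrite /hex /=.
have opp_fixed (z : T) : - z = z <-> z + z = 0.
  split=> [zz|/eqP]; first by rewrite -{1}zz addNr.
  by rewrite addr_eq0 => /eqP/esym.
by rewrite !opp_fixed.
Qed.

End Hexagonal.

(** B is a copy of Z[omega] / (omega^n - 1), with x and y in the places of 1 and
    omega.  As omega acts on a pair by shifting the sequence, the two
    equations say that omega^n fixes 1 and omega; the last clause says that
    they imply every relation between x and y. *)
Definition hex_presented n (B : zmodType) (x y : B) : Prop :=
  [/\ hex x y n = x, hex x y n.+1 = y,
      forall u : B, exists p q : int, u = (x *~ p + y *~ q)%R
    & forall (T : zmodType) (x' y' : T),
        hex x' y' n = x' -> hex x' y' n.+1 = y' ->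
      exists phi : {additive B -> T}, phi x = x' /\ phi y = y'].

(** * The Cayley graph of the dihedral group *)

Lemma cayley_in_edges (gT : finGroupType) (S : {set gT}) (T : zmodType)
    (w : gT -> T) (h : gT) :
  (\sum_(e : edge (cayley_digraph S) | target e == h) w (source e)
   = \sum_(s in S) w (h * s^-1)%g)%R.
Proof.
rewrite [RHS]big_sub.
rewrite (reindex (fun s : {s | s \in S} => ((h * (val s)^-1)%g, s))) /=.
  by apply: eq_bigl => s; rewrite /= mulgKV eqxx.
by exists snd => [s //|[g s]]; rewrite inE /= => /eqP <-; rewrite mulgK.
Qed.

Section ModelRotation.
Local Open Scope group_scope.

Definition model_sigma m : dihedral_model m := (inZp 1, false).
Definition model_tau m : dihedral_model m := (0%R, true).

Lemma model_sigmaX m k :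
  model_sigma m ^+ k = (inZp k, false) :> dihedral_model m.
Proof.
elim: k => [|k IH]; first by congr (_, _); apply: val_inj; rewrite /= mod0n.
rewrite expgS IH; congr (_, _); apply: val_inj => /=.
by rewrite modnDm add1n.
Qed.

Lemma opp_inZp1 m : (- inZp 1 = inZp m :> 'I_m.+1)%R.
Proof.
apply/eqP; rewrite eq_sym -subr_eq0 opprK; apply/eqP/val_inj => /=.
by rewrite modnDm addn1 modnn.
Qed.

Lemma dihedral_model_rel m : dihedral_rel m.+1 (model_sigma m) (model_tau m).
Proof.
split.
- by rewrite model_sigmaX; congr (_, _); apply: val_inj; rewrite /= modnn.
- by congr (_, _); rewrite /= oppr0 addr0.
- by congr (_, _); rewrite /= add0r oppr0 addr0.
Qed.

End ModelRotation.

Section Dihedral.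
Variables (n : nat) (gT : finGroupType) (sigma tau : gT).
Hypotheses (n_gt0 : 0 < n) (D2n : dihedral_presentation n sigma tau).
Local Notation X := (cayley_digraph [set sigma; tau]%SET).
Local Notation BF := (bowen_franks X).

(** The normal form sigma^a tau^b is read through this morphism: it yields
    well-defined functions on the group, as [rot_class_lift] needs. *)
Lemma dihedral_to_model : exists f : gT -> dihedral_model n.-1,
  [/\ {morph f : u v / (u * v)%g}, f sigma = model_sigma n.-1
    & f tau = model_tau n.-1].
Proof.
case: D2n => _ _; apply; rewrite -{1}(prednK n_gt0); exact: dihedral_model_rel.
Qed.

(** The two generators are distinct, even for n = 1 and n = 2: the model tells
    rotations from reflections.  A coincidence would leave a single edge
    where the relations need two. *)
Lemma sum_dihedral_generators (T : zmodType) (F : gT -> T) :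
  (\sum_(s in [set sigma; tau]%SET) F s = F sigma + F tau)%R.
Proof.
rewrite big_setU1 ?big_set1 //= inE; apply/eqP => st.
have [f [_ fs ft]] := dihedral_to_model.
by move: fs; rewrite st ft.
Qed.

Definition rot_class k : BF := vertex_class (X := X) (sigma ^+ k)%g.

Lemma vertex_class_dihedral (g : gT) :
  (vertex_class (X := X) g = vertex_class (X := X) (g * sigma^-1)%g
                           + vertex_class (X := X) (g * tau)%g)%R.
Proof.
rewrite [LHS]vertex_class_in_edges.
rewrite (cayley_in_edges _ (vertex_class (X := X))) sum_dihedral_generators.
have [_ [_ tau2 _] _] := D2n.
have -> // : (tau^-1 = tau)%g.
by apply/eqP; rewrite eq_invg_mul -tau2.
Qed.

(** Compare the relations at sigma^k tau and at sigma^(k+1): since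
    tau sigma^-1 = sigma tau, their right-hand sides have the same two terms. *)
Lemma vertex_class_reflection k :
  vertex_class (X := X) (sigma ^+ k * tau)%g = rot_class k.+1.
Proof.
have [_ [_ tau2 tst] _] := D2n.
have tt : (tau * tau = 1)%g by [].
rewrite vertex_class_dihedral /rot_class [RHS]vertex_class_dihedral addrC.
rewrite -!mulgA tt mulg1 expgSr mulgK -!mulgA -tst.
by rewrite (mulgA tau) (mulgA tau) tt mul1g.
Qed.

Lemma rot_class_rec k :
  (rot_class k.+1 = rot_class k + rot_class k.+2)%R.
Proof.
rewrite /rot_class [LHS]vertex_class_dihedral vertex_class_reflection.
by rewrite expgSr mulgK.
Qed.

Lemma rot_class_hex k : rot_class k = hex (rot_class 0) (rot_class 1) k.
Proof. exact: hex_unique rot_class_rec k. Qed.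

Lemma rot_class_period k : rot_class (k + n) = rot_class k.
Proof. by have [_ [sn _ _] _] := D2n; rewrite /rot_class expgD sn mulg1. Qed.

Lemma dihedral_elementP (g : gT) :
  exists k, g = (sigma ^+ k)%g \/ g = (sigma ^+ k * tau)%g.
Proof.
have [gen [_ tau2 tst] _] := D2n.
have tau_norm : (<[tau]> \subset 'N(<[sigma]>))%g.
  rewrite cycle_subG inE -cycleJ cycle_subG.
  by rewrite /conjg -(_ : tau = tau^-1)%g ?mulgA ?tst ?groupV ?cycle_id //;
     apply/esym/eqP; rewrite eq_invg_mul -tau2.
have : g \in (<[sigma]> * <[tau]>)%g.
  rewrite -norm_joinEr //.
  apply: (fintype.subsetP _ g (_ : g \in <<[set sigma; tau]>>%g)).
    rewrite gen_subG finset.subUset !finset.sub1set.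
    by rewrite !mem_gen // inE cycle_id ?orbT.
  by rewrite gen inE.
case/mulsgP=> _ _ /cycleP[k ->] /cycleP[l ->] ->; exists k.
rewrite (divn_eq l 2) mulnC expgD expgM tau2 expg1n mul1g modn2.
by case: odd; [right; rewrite expg1|left; rewrite mulg1].
Qed.

Lemma rot_class_span (u : BF) :
  exists p q : int, (u = rot_class 0 *~ p + rot_class 1 *~ q)%R.
Proof.
have [m ->] := vertex_class_span u.
pose spanned (v : BF) := exists p q : int,
  (v = rot_class 0 *~ p + rot_class 1 *~ q)%R.
have rot k : spanned (rot_class k).
  rewrite rot_class_hex /hex; have := ltn_pmod k (isT : 0 < 6).
  case: (k %% 6) => [|[|[|[|[|[|//]]]]]] _ /=.
  - by exists 1%R, 0%R; rewrite mulr1z mulr0z addr0.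
  - by exists 0%R, 1%R; rewrite mulr1z mulr0z add0r.
  - by exists (-1)%R, 1%R; rewrite mulrNz !mulr1z addrC.
  - by exists (-1)%R, 0%R; rewrite mulrNz !mulr1z mulr0z addr0.
  - by exists 0%R, (-1)%R; rewrite mulrNz !mulr1z mulr0z add0r.
  - by exists 1%R, (-1)%R; rewrite mulrNz !mulr1z.
apply: (big_ind spanned) => [|v1 v2 [p1 [q1 ->]] [p2 [q2 ->]]|g _].
- by exists 0%R, 0%R; rewrite !mulr0z addr0.
- by exists (p1 + p2)%R, (q1 + q2)%R; rewrite !mulrzDr addrACA.
have [p [q ->]] : spanned (vertex_class (X := X) g).
  have [k [->|->]] := dihedral_elementP g; first exact: rot.
  by rewrite vertex_class_reflection; exact: rot.
by exists (p * m g)%R, (q * m g)%R; rewrite mulrzDl !mulrzA.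
Qed.

(** The image of sigma^a tau^b must be the term of index a + b, by
    [vertex_class_reflection].  Periodicity makes this independent of the
    choice of a modulo n, and both families of relations then become the
    recurrence. *)
Lemma rot_class_lift (T : zmodType) (x y : T) :
    hex x y n = x -> hex x y n.+1 = y ->
  exists phi : {additive BF -> T},
    phi (rot_class 0) = x /\ phi (rot_class 1) = y.
Proof.
move=> hn hn1; have [f [fM fs ft]] := dihedral_to_model.
have hexn := hex_period hn hn1.
have hexmul i k : hex x y (k + i * n) = hex x y k.
  by elim: i k => [|i IH] k; rewrite ?mul0n ?addn0 // mulSn addnA IH hexn.
have hexmod k l : hex x y (k %% n.-1.+1 + l) = hex x y (k + l).
  by rewrite prednK // {2}(divn_eq k n) -addnA [(_ * n + _)%N]addnC hexmul.
have f1 : f 1%g = 1%g by apply: (mulgI (f 1%g)); rewrite -fM !mulg1.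
have fV u : (f u^-1 = (f u)^-1)%g.
  by apply: (mulgI (f u)); rewrite -fM !mulgV.
have fX k : (f (sigma ^+ k) = f sigma ^+ k)%g.
  by elim: k => [|k IH]; rewrite ?expg0 // !expgS fM IH.
pose w (g : gT) := hex x y ((f g).1 + (f g).2).
have w_in g : (w g = \sum_(e : edge X | target e == g) w (source e))%R.
  rewrite (cayley_in_edges _ w) sum_dihedral_generators /w !fM !fV fs ft.
  case: (f g) => a b; rewrite /= !hexmod /flip !oppr0 opprK opp_inZp1 if_same.
  case: b => /=.
    rewrite !addn0 addn1 hex_rec addrC; congr (_ + _)%R.
    by rewrite -addnA addnCA hexmod add1n addn1.
  (* For a rotation, g sigma^-1 has index a + (n - 1), not a - 1: the recurrence
     is used there and then shifted back by n. *)
  have an : a + n = (a + n.-1).+1 by rewrite -addnS; congr addn; rewrite prednK.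
  rewrite !addn0 [a + _]addnC hexmod [n.-1 + a]addnC addn1.
  by rewrite -(hexn a) -(hexn a.+1) addSn an hex_rec.
have [phi phiE] := @bowen_franks_lift X T w w_in.
have phi_rot k : phi (rot_class k) = hex x y k.
  by rewrite phiE /w fX fs model_sigmaX /= hexmod addn0.
by exists phi; rewrite !phi_rot.
Qed.

Lemma dihedral_hex_presented : hex_presented n (rot_class 0) (rot_class 1).
Proof.
split; [ | |exact: rot_class_span|exact: rot_class_lift].
  by rewrite -rot_class_hex -[n]add0n rot_class_period.
by rewrite -rot_class_hex -add1n rot_class_period.
Qed.
End Dihedral.

(** * Cardinality of the quotients of Z[omega] *)

Lemma card_bijective_fin (T : Type) (F : finType) (f : T -> F) :
  injective f -> (forall y, exists x, f x = y) -> ([set: T] #= `I_#|F|)%card.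
Proof.
move=> f_inj f_surj; apply/card_set_bijP.
exists (fun x => enum_rank (f x) : nat).
split=> [x _|x y _ _ /ord_inj/enum_rank_inj/f_inj //|k /= kF].
  exact: ltn_ord.
have [x fx] := f_surj (enum_val (Ordinal kF)).
by exists x => //; rewrite fx enum_valK.
Qed.

Lemma mulrz_torsion (T : zmodType) (z : T) m (p : int) :
  0 < m -> (z *+ m = 0 -> exists2 k, (k < m)%N & z *~ p = z *+ k)%R.
Proof.
move=> m_gt0 zm; exists `|(p %% m)%Z|%N.
  by rewrite -ltz_nat gez0_abs ?modz_ge0 ?ltz_pmod // -?lt0n; lia.
rewrite {1}(divz_eq p m) mulrzDr mulrC mulrzA -pmulrn zm mul0rz add0r.
by rewrite pmulrn gez0_abs ?modz_ge0 //; lia.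
Qed.

Section HexPresentedCard.
Local Open Scope ring_scope.
Variables (n : nat) (B : zmodType) (x y : B).
Hypothesis Bxy : hex_presented n x y.

Lemma hex_presented_card1 :
  (n %% 6 = 1 \/ n %% 6 = 5)%N -> ([set: B] #= `I_1)%card.
Proof.
move=> n6; have [fix0 fix1 span _] := Bxy.
have [x0 y0] := hex_fixed_mod6_pm1 n6 fix0 fix1.
rewrite -card_unit; apply: (@card_bijective_fin _ unit (fun=> tt)).
  move=> u v _; have [p [q ->]] := span u; have [p' [q' ->]] := span v.
  by rewrite x0 y0 !mul0rz.
by case; exists 0.
Qed.

(** Here y = - x and 3 x = 0, so B consists of 0, x and 2 x; the map to Z/3 with
    x |-> 1 and y |-> -1 tells them apart. *)
Lemma hex_presented_card3 :
  (n %% 6 = 2 \/ n %% 6 = 4)%N -> ([set: B] #= `I_3)%card.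
Proof.
move=> n6; have [fix0 fix1 span lift] := Bxy.
have [yx x3] := (hex_fixed_mod6_pm2 x y n6).1 (conj fix0 fix1).
have [|h0 h1] := (hex_fixed_mod6_pm2 (1 : 'Z_3) (- 1) n6).2.
  by split=> //; apply: val_inj.
have [phi [phix _]] := lift _ _ _ h0 h1.
have spanx u : exists2 k, (k < 3)%N & u = x *+ k.
  have [p [q ->]] := span u.
  by rewrite yx mulNrz -mulrzBr; exact: mulrz_torsion.
have phiX k : phi (x *+ k) = k%:R by rewrite raddfMn phix.
rewrite -[3%N](card_ord 3); apply: (@card_bijective_fin _ 'Z_3 phi).
  move=> u v; have [k k3 ->] := spanx u; have [l l3 ->] := spanx v.
  rewrite !phiX => /(congr1 val).
  by rewrite /= !val_Zp_nat // !modn_small // => ->.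
by move=> k; exists (x *+ k); rewrite phiX natr_Zp.
Qed.

(** Here 2 x = 2 y = 0, so B consists of 0, x, y and x + y; the map to (Z/2)^2
    that sends x and y to the standard basis tells them apart. *)
Lemma hex_presented_card4 : (n %% 6 = 3)%N -> ([set: B] #= `I_4)%card.
Proof.
move=> n6; have [fix0 fix1 span lift] := Bxy.
have [x2 y2] := (hex_fixed_mod6_3 x y n6).1 (conj fix0 fix1).
pose V : zmodType := ('Z_2 * 'Z_2)%type.
have [|h0 h1] := (hex_fixed_mod6_3 ((1, 0) : V) (0, 1) n6).2.
  by split; congr (_, _); apply: val_inj.
have [phi [phix phiy]] := lift _ _ _ h0 h1.
have span2 u : exists k l, [/\ (k < 2)%N, (l < 2)%N & u = x *+ k + y *+ l].
  have [p [q ->]] := span u.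
  have [k k2 ->] := mulrz_torsion p (isT : (0 < 2)%N) x2.
  by have [l l2 ->] := mulrz_torsion q (isT : (0 < 2)%N) y2; exists k, l.
have e1M k : ((1, 0) : V) *+ k = (k%:R, 0).
  by elim: k => // k IH; rewrite !mulrS IH; congr (_, _); rewrite addr0.
have e2M k : ((0, 1) : V) *+ k = (0, k%:R).
  by elim: k => // k IH; rewrite !mulrS IH; congr (_, _); rewrite addr0.
have phiE k l : phi (x *+ k + y *+ l) = (k%:R, l%:R).
  rewrite raddfD !raddfMn phix phiy e1M e2M.
  by congr (_, _); rewrite ?addr0 ?add0r.
have -> : 4%N = #|{: 'Z_2 * 'Z_2}| by rewrite card_prod !card_ord.
apply: (@card_bijective_fin _ _ phi).
  move=> u v; have [k [l [k2 l2 ->]]] := span2 u.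
  have [k' [l' [k'2 l'2 ->]]] := span2 v.
  rewrite !phiE => -[/(congr1 val) + /(congr1 val)].
  by rewrite /= !val_Zp_nat // !modn_small // => -> ->.
by case=> k l; exists (x *+ k + y *+ l); rewrite phiE !natr_Zp.
Qed.

(** Every pair satisfies omega^n = 1, so B maps onto Z by x |-> 1, y |-> 0. *)
Lemma hex_presented_infinite : (n %% 6 = 0)%N -> infinite_set [set: B].
Proof.
move=> n6; have [_ _ _ lift] := Bxy.
have [h0 h1] := hex_fixed_mod6_0 (1 : int) 0 n6.
have [phi [phix _]] := lift _ _ _ h0 h1.
move=> /(finite_image (fun u => `|phi u|%N)); apply: contra_not _ infinite_nat.
apply: sub_finite_set => k _; exists (x *+ k) => //=.
by rewrite raddfMn phix; lia.
Qed.

End HexPresentedCard.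

Lemma modz6_nat (n r : nat) (z : int) :
  (n = z %[mod 6])%Z -> (z %% 6)%Z = r -> n %% 6 = r.
Proof. by move=> nz zr; apply/eqP; rewrite -eqz_nat -modz_nat nz zr. Qed.

Theorem proposition3p3 (n : nat) (gT : finGroupType) (sigma tau : gT)
    (n_ge1 : 1 <= n) (D2n : dihedral_presentation n sigma tau) :
  let BF := [set: bowen_franks (cayley_digraph [set sigma; tau]%SET)]%classic in
  (infinite_set BF <-> (6 %| n)%N) /\
  (~~ (6 %| n)%N ->
    [/\ finite_set BF,
        (n = 1 %[mod 6])%Z \/ (n = -1 %[mod 6])%Z -> (BF #= `I_1)%card,
        (n = 2 %[mod 6])%Z \/ (n = -2 %[mod 6])%Z -> (BF #= `I_3)%card
      & (n = 3 %[mod 6])%Z -> (BF #= `I_4)%card]).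
Proof.
move=> BF.
have BFxy := dihedral_hex_presented n_ge1 D2n.
have card1 := hex_presented_card1 BFxy.
have card3 := hex_presented_card3 BFxy.
have card4 := hex_presented_card4 BFxy.
have finite : ~~ (6 %| n) -> finite_set BF.
  rewrite /dvdn; have := ltn_pmod n (isT : 0 < 6).
  case n6: (n %% 6) => [|[|[|[|[|[|//]]]]]] _ // _.
  - by apply/finite_setP; exists 1; apply: card1; left.
  - by apply/finite_setP; exists 3; apply: card3; left.
  - by apply/finite_setP; exists 4; exact: card4.
  - by apply/finite_setP; exists 3; apply: card3; right.
  - by apply/finite_setP; exists 1; apply: card1; right.
split.
  split=> [inf|/eqP]; first by apply/negPn/negP => /finite.
  exact: hex_presented_infinite BFxy.
move=> n6; split; first exact: finite.
- by move=> [] /modz6_nat e; apply: card1; [left|right]; apply: e.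
- by move=> [] /modz6_nat e; apply: card3; [left|right]; apply: e.
- by move=> /modz6_nat e; apply: card4; apply: e.
Qed.
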